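(* Let $\theta\ge\sigma>0$, $n\geq 1$, $M\ge1$, $\Upsilon>0$. Then $$\epsilon_{\mathrm{a}}^{\star}(n,M,\Upsilon)\;\geq\;\underline{f}\bigl(\tfrac1M,\Upsilon\bigr),$$ where $\underline{f}$ is the lower convex envelope of $f(\beta,\gamma)=\alpha_\beta(\varphi^n_{\sqrt\gamma,\sigma},\varphi^n_{0,\theta})$ on the domain $\beta\in[0,1]$, $\gamma\ge0$.
   Context: $\varphi_{\mu,\sigma}(y)=\frac{1}{\sqrt{2\pi}\sigma}e^{-(y-\mu)^2/(2\sigma^2)}$; $\varphi^n_{\mu,\sigma}$ is the distribution on $\mathbb{R}^n$ of $n$ i.i.d. $\mathcal{N}(\mu,\sigma^2)$ coordinates. $\alpha_\beta(A,B)=\inf\{1-\mathbb{E}_A[T]:\ T\to[0,1],\ \mathbb{E}_B[T]\le\beta\}$. The lower convex envelope $\underline f=f^{**}$ is the biconjugate (double Legendre–Fenchel transform) of $f$, i.e. the largest lower semicontinuous convex function on the domain majorized by $f$. AWGN channel with noise variance $\sigma^2$: input $\mathbf{x}\in\mathbb{R}^n$, output density $\prod_i\varphi_{x_i,\sigma}(y_i)$; for a codebook $\mathcal{C}=\{\mathbf{c}_1,\dots,\mathbf{c}_M\}\subset\mathbb{R}^n$ with uniform message and maximum-likelihood decoding, $P_e(\mathcal{C})$ is the average error probability; $\epsilon_{\mathrm{a}}^{\star}(n,M,\Upsilon)=\inf\{P_e(\mathcal{C}):\frac1M\sum_{i=1}^M\|\mathbf{c}_i\|^2\le n\Upsilon\}$.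 *)

(* Defs.v *)
From HB Require Import structures.
From mathcomp Require Import all_boot all_order all_algebra.
From mathcomp Require Import all_classical all_reals all_analysis.
Set Implicit Arguments. Unset Strict Implicit. Unset Printing Implicit Defensive.
Import Order.TTheory GRing.Theory Num.Theory.
Import numFieldNormedType.Exports.
Local Open Scope classical_set_scope.
Local Open Scope ring_scope.

Section Defs.
Variable R : realType.

Definition phi (mu s y : R) : R :=
  (Num.sqrt (2 * pi) * s)^-1 * expR (- ((y - mu) ^+ 2) / (2 * s ^+ 2)).

Fixpoint iint (k : nat) (g : seq R -> \bar R) : \bar R :=
  match k with
  | 0 => g [::]
  | k'.+1 => (\int[@lebesgue_measure R]_x iint k' (fun s => g (x :: s)))%E
  end.

Definition zero_tuple (n : nat) : n.-tuple R := [tuple of nseq n 0].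
Definition cst_tuple (n : nat) (a : R) : n.-tuple R := [tuple of nseq n a].

Definition gdens (n : nat) (mu : n.-tuple R) (s : R) (y : n.-tuple R) : R :=
  \prod_(i < n) phi (tnth mu i) s (tnth y i).

Definition Egauss (n : nat) (mu : n.-tuple R) (s : R) (T : n.-tuple R -> R)
  : \bar R :=
  iint n (fun v => let y := insubd (zero_tuple n) v in (T y * gdens mu s y)%:E).

Definition tests (n : nat) : set (n.-tuple R -> R) :=
  [set T : n.-tuple R -> R | measurable_fun setT T /\ forall y, 0 <= T y <= 1].

Definition alpha (n : nat) (beta : R) (muA : n.-tuple R) (sA : R)
  (muB : n.-tuple R) (sB : R) : \bar R :=
  ereal_inf [set (1 - Egauss muA sA T)%E | T in
    [set T : n.-tuple R -> R | @tests n T /\ (Egauss muB sB T <= beta%:E)%E]].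

Definition fmc (n : nat) (sigma theta : R) (beta gamma : R) : \bar R :=
  alpha beta (cst_tuple n (Num.sqrt gamma)) sigma (zero_tuple n) theta.

Definition fdom : set (R * R) := [set p | 0 <= p.1 <= 1 /\ 0 <= p.2].

(* Legendre-Fenchel conjugate of f restricted to fdom (= +oo outside). *)
Definition conj2 (f : R -> R -> \bar R) (a b : R) : \bar R :=
  ereal_sup [set ((a * p.1 + b * p.2)%:E - f p.1 p.2)%E | p in fdom].

(* Biconjugate: lower convex envelope of f on fdom. *)
Definition lower_env (f : R -> R -> \bar R) (x y : R) : \bar R :=
  ereal_sup [set ((q.1 * x + q.2 * y)%:E - conj2 f q.1 q.2)%E | q in [set: R * R]].

Definition lik (n M : nat) (sigma : R) (c : 'I_M -> n.-tuple R) (j : 'I_M)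
  (y : n.-tuple R) : R := gdens (c j) sigma y.

(* Maximum-likelihood decoder (ties broken toward the smallest index) errs
   on message i iff some j has strictly larger likelihood, or equal
   likelihood and smaller index. *)
Definition ml_err (n M : nat) (sigma : R) (c : 'I_M -> n.-tuple R) (i : 'I_M)
  (y : n.-tuple R) : R :=
  if `[< exists j : 'I_M, lik sigma c i y < lik sigma c j y \/
                          (lik sigma c j y = lik sigma c i y /\ (j < i)%N) >]
  then 1 else 0.

Definition Pe (n M : nat) (sigma : R) (c : 'I_M -> n.-tuple R) : \bar R :=
  ((M%:R)^-1%:E * \sum_(i < M) Egauss (c i) sigma (ml_err sigma c i))%E.

Definition power_ok (n M : nat) (Ups : R) (c : 'I_M -> n.-tuple R) : Prop :=
  (M%:R)^-1 * \sum_(i < M) \sum_(k < n) (tnth (c i) k) ^+ 2 <= n%:R * Ups.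

Definition eps_star (n M : nat) (Ups sigma : R) : \bar R :=
  ereal_inf [set Pe sigma c | c in [set c : 'I_M -> n.-tuple R | power_ok Ups c]].

End Defs.

(* Main.v *)
(* Meta-converse with a centred Gaussian auxiliary output law.  The maximum
   likelihood decoding regions of a code partition the output space, so, seen as
   tests, they have sizes [beta_i] summing to [1] under N(0, theta^2)^n, and
   the error of message [i] is at least [alpha] at [beta_i] for the mean [c_i].
   By rotational invariance this only depends on [gamma_i = |c_i|^2 / n], which
   gives [f (beta_i, gamma_i)].  Rotations are built as compositions of plane
   rotations of consecutive coordinates (and a reflection when [n = 1]), each of
   which preserves the iterated Lebesgue integral.  Finally an affine minorant
   [a * beta + b * gamma - f^*(a, b)] of [f] is averaged over the messages: the
   mean of [beta_i] is [1 / M], and [f <= 1] forces [b <= 0] whenever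
   [f^*(a, b)] is finite, so the power constraint can be used. *)

Require Import Defs.
From HB Require Import structures.
From mathcomp Require Import all_boot all_order all_algebra.
From mathcomp Require Import all_classical all_reals all_analysis.
From mathcomp Require Import measurable_realfun ring lra.
Import Order.TTheory GRing.Theory Num.Theory.
Import numFieldNormedType.Exports.
Local Open Scope classical_set_scope.
Local Open Scope ring_scope.

(** * Affine substitutions for Lebesgue measure on the line *)

Section affine_change_of_variables.
Context {R : realType}.
Notation leb := (@lebesgue_measure R).

Lemma measurable_affine (a b : R) :
  measurable_fun [set: measurableTypeR R]
    ((fun x => a * x + b) : measurableTypeR R -> measurableTypeR R).
Proof. by apply: measurable_funD => //; exact: measurable_funM. Qed.

(** By uniqueness of Lebesgue measure it is enough to compare both sides on half-open intervals; the
    right-hand side is a measure in [X], namely a scaled pushforward. *)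
Lemma lebesgue_measure_affine (a b : R) (a0 : a != 0) (X : set R) :
  measurable X ->
  leb X = (`|a|%:E * leb ((fun x => a * x + b)%R @^-1` X))%E.
Proof.
pose F := (fun x => a * x + b) : measurableTypeR R -> measurableTypeR R.
pose mF : measurable_fun setT F := measurable_affine a b.
pose k : {nonneg R} := NngNum (normr_ge0 a).
pose m0 :=
  measure_function_pushforward__canonical__measure_function_Measure leb mF.
pose m := mscale k m0.
rewrite -[RHS]/(m X); apply: lebesgue_measure_unique => _ [[u v] _ <-] /=.
rewrite /m /mscale/= /pushforward/= /F.
have [a_gt0|a_lt0|/eqP] := ltgtP 0 a; last by rewrite eq_sym (negbTE a0).
- rewrite (_ : _ @^-1` _ = `](u - b) / a, (v - b) / a]%classic); last first.
    apply/seteqP; split => x /=; rewrite !in_itv/= ltr_pdivrMr// ler_pdivlMr//;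
      rewrite (mulrC x) ltrBlDr lerBrDr//.
  rewrite !lebesgue_measure_itv/= !lte_fin ltr_pM2r ?invr_gt0// ltrD2r.
  case: ifP => _; last by rewrite mule0.
  by rewrite -!EFinD -EFinM gtr0_norm//; congr EFin; field.
(* A negative slope swaps the endpoints and moves the open end to the right; the length is
   unaffected. *)
- rewrite (_ : _ @^-1` _ = `[(v - b) / a, (u - b) / a[%classic); last first.
    apply/seteqP; split => x /=; rewrite !in_itv/= ltr_ndivlMr// ler_ndivrMr//;
      rewrite (mulrC x) ltrBlDr lerBrDr// andbC //.
  rewrite !lebesgue_measure_itv/= !lte_fin ltr_nM2r ?invr_lt0// ltrD2r.
  case: ifP => _; last by rewrite mule0.
  by rewrite -!EFinD -EFinM ltr0_norm//; congr EFin; field.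
Qed.

Lemma ge0_integral_affine (a b : R) (f : R -> \bar R) : a != 0 ->
  measurable_fun [set: R] f -> (forall x, 0 <= f x)%E ->
  (\int[leb]_x f x = `|a|%:E * \int[leb]_x f (a * x + b)%R)%E.
Proof.
move=> a0 mf f0.
pose F := (fun x => a * x + b) : measurableTypeR R -> measurableTypeR R.
pose mF : measurable_fun setT F := measurable_affine a b.
pose k : {nonneg R} := NngNum (normr_ge0 a).
pose m0 :=
  measure_function_pushforward__canonical__measure_function_Measure leb mF.
transitivity (\int[mscale k m0]_x f x)%E.
  apply: eq_measure_integral => X mX _; exact: lebesgue_measure_affine.
rewrite ge0_integral_mscale//.
by rewrite ge0_integral_pushforward//.
Qed.

End affine_change_of_variables.

(** * Invariance of the double Lebesgue integral under plane rotations *)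

Section plane_rotation.
Context {R : realType}.
Notation leb := (@lebesgue_measure R).

Lemma measurable_fun_pairR {d} {X : measurableType d} (u v : X -> R)
    (g : R * R -> \bar R) :
  measurable_fun setT g -> measurable_fun setT u -> measurable_fun setT v ->
  measurable_fun setT (fun x => g (u x, v x)).
Proof.
move=> mg mu mv.
by apply: (@measurableT_comp _ _ _ _ _ _ g) => //; exact: measurable_fun_pair.
Qed.

Lemma fubini_lebesgue (g : R * R -> \bar R) :
  measurable_fun setT g -> (forall z, 0 <= g z)%E ->
  (\int[leb]_x \int[leb]_y g (x, y) = \int[leb]_y \int[leb]_x g (x, y))%E.
Proof. by move=> mg g0; exact: (@fubini_tonelli _ _ _ _ R leb leb g). Qed.

Lemma measurable_integral_lebesgue {d} {X : measurableType d}
    (g : X * R -> \bar R) :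
  measurable_fun setT g -> (forall z, 0 <= g z)%E ->
  measurable_fun setT (fun x => \int[leb]_y g (x, y))%E.
Proof.
by move=> mg g0; exact: (@measurable_fun_fubini_tonelli_F _ _ X _ R leb g).
Qed.

(* For [c != 0] the rotation is the composite of the two one-variable affine
   changes [(u, y) |-> (u, (y - s u) / c)] and [(x, y) |-> (c x + s y, y)], whose
   Jacobians [1 / c] and [c] cancel. *)
Lemma ge0_integral_rotation (c s : R) (g : R * R -> \bar R) :
  c ^+ 2 + s ^+ 2 = 1 ->
  measurable_fun setT g -> (forall z, 0 <= g z)%E ->
  (\int[leb]_x \int[leb]_y g (c * x + s * y, c * y - s * x)%R =
   \int[leb]_x \int[leb]_y g (x, y))%E.
Proof.
move=> cs1 mg g0.
have mlin (a b : R) : measurable_fun setT (fun z : R * R => a * z.1 + b * z.2).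
  by apply: measurable_funD; apply: measurable_funM.
have mlin' (a b : R) : measurable_fun setT (fun z : R * R => a * z.2 - b * z.1).
  by apply: measurable_funB; apply: measurable_funM.
(* For [c = 0] one has [|s| = 1]: the rotation swaps the coordinates up to signs, so Fubini and
   reflections suffice. *)
have [c0|c0] := eqVneq c 0.
  have s2 : s ^+ 2 = 1 by rewrite -cs1 c0 expr0n add0r.
  have s0 : s != 0 by apply: contra_eq_neq s2 => ->; rewrite expr0n eq_sym oner_eq0.
  have ns : `|s| = 1.
    by apply/eqP; rewrite -(@eqrXn2 _ 2)// -normrX s2 expr1n normr1.
  transitivity (\int[leb]_x \int[leb]_u g (u, - s * x)%R)%E.
    apply: eq_integral => x _.
    rewrite [RHS](@ge0_integral_affine R s 0)//; last exact: measurable_fun_pairR.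
    rewrite ns mul1e; apply: eq_integral => y _; congr (g (_, _)); rewrite c0; ring.
  rewrite (fubini_lebesgue (fun z => g (z.2, - s * z.1)%R))//=; last first.
    by apply: measurable_fun_pairR => //; exact: measurable_funM.
  apply: eq_integral => u _.
  rewrite [RHS](@ge0_integral_affine R (- s) 0) ?oppr_eq0//; last first.
    exact: measurable_fun_pairR.
  by rewrite normrN ns mul1e; apply: eq_integral => y _; rewrite addr0.
have E y : (\int[leb]_x g (c * x + s * y, c * y - s * x)%R =
    `|c^-1|%:E * \int[leb]_u g (u, c^-1 * y + - (s / c) * u)%R)%E.
  rewrite (@ge0_integral_affine R c (s * y)
    (fun u => g (u, c^-1 * y + - (s / c) * u)%R))//; last first.
    apply: measurable_fun_pairR => //.
    by apply: measurable_funD => //; exact: measurable_funM.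
  rewrite muleA -EFinM -normrM mulVf// normr1 mul1e.
  apply: eq_integral => x _; congr (g (_, _)).
  have -> : c * y - s * x = (c ^+ 2 * y - s * c * x) / c by field.
  have -> : c ^+ 2 = 1 - s ^+ 2 by rewrite -cs1 addrK.
  by field.
rewrite (fubini_lebesgue (fun z => g (c * z.1 + s * z.2, c * z.2 - s * z.1)%R))//=;
  last exact: measurable_fun_pairR.
under eq_integral do rewrite E.
have mh : measurable_fun setT
    (fun z : R * R => g (z.2, c^-1 * z.1 + - (s / c) * z.2)%R).
  exact: measurable_fun_pairR.
rewrite ge0_integralZl//; last 2 first.
- exact: (measurable_integral_lebesgue
    (fun z : R * R => g (z.2, c^-1 * z.1 + - (s / c) * z.2)%R)).
- by move=> y _; exact: integral_ge0.
rewrite (fubini_lebesgue (fun z => g (z.2, c^-1 * z.1 + - (s / c) * z.2)%R))//=.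
rewrite -ge0_integralZl//; last 2 first.
- apply: (measurable_integral_lebesgue
    (fun z : R * R => g (z.1, c^-1 * z.2 + - (s / c) * z.1)%R)) => //.
  apply: measurable_fun_pairR => //.
  by apply: measurable_funD => //; exact: measurable_funM.
- by move=> y _; exact: integral_ge0.
apply: eq_integral => u _.
rewrite [RHS](@ge0_integral_affine R c^-1 (- (s / c) * u)) ?invr_eq0//.
exact: measurable_fun_pairR.
Qed.

End plane_rotation.

(** * Iterated integrals over tuples and the total mass of the Gaussian density *)

Section iterated_integral.
Context {R : realType}.
Notation leb := (@lebesgue_measure R).

(** A form of [iint] with typed length: tuples carry a sigma-algebra, so measurability of the
    integrand can be stated, and no default value is needed. *)
Fixpoint tint (n : nat) : (n.-tuple R -> \bar R) -> \bar R :=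
  match n with
  | 0 => fun g => g [tuple]
  | n'.+1 => fun g => (\int[leb]_x tint n' (fun t => g [tuple of x :: t]))%E
  end.

(** The lists produced by [iint n] all have length [n], so the default of [insubd] is never
    reached. *)
Lemma iint_tint (n : nat) (h : n.-tuple R -> \bar R) :
  iint n (fun v => h (insubd (zero_tuple R n) v)) = tint n h.
Proof.
have H k (g : seq R -> \bar R) : iint k g = tint k (fun t => g (tval t)).
  elim: k g => [//|k IH] g /=.
  by apply: eq_integral => x _; rewrite IH.
by rewrite H; congr tint; apply/funext => t; rewrite -[tval t]/(val t) valKd.
Qed.

Lemma EgaussE (n : nat) (mu : n.-tuple R) (s : R) (T : n.-tuple R -> R) :
  Egauss mu s T = tint n (fun y => (T y * gdens mu s y)%:E).
Proof. exact: (iint_tint n (fun y => (T y * gdens mu s y)%:E)). Qed.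

Lemma tint_ge0 (n : nat) (g : n.-tuple R -> \bar R) :
  (forall t, 0 <= g t)%E -> (0 <= tint n g)%E.
Proof.
by elim: n g => [|n IH] g g0 //=; apply: integral_ge0 => x _; exact: IH.
Qed.

(** The parameter space is arbitrary so that the induction can absorb the head coordinate into it,
    passing from [X] to [X * R]. *)
Lemma measurable_tint {d} {X : measurableType d} (n : nat)
    (g : X * n.-tuple R -> \bar R) :
  measurable_fun setT g -> (forall z, 0 <= g z)%E ->
  measurable_fun setT (fun x => tint n (fun t => g (x, t))).
Proof.
elim: n d X g => [|n IH] d X g mg g0 /=.
  by apply: (@measurableT_comp _ _ _ _ _ _ g) => //; exact: measurable_fun_pair.
apply: (measurable_integral_lebesgue
  (fun z : X * R => tint n (fun t => g (z.1, [tuple of z.2 :: t])))); last first.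
  by move=> z; exact: tint_ge0.
apply: (IH _ (X * R)%type (fun z : (X * R) * n.-tuple R =>
  g (z.1.1, [tuple of z.1.2 :: z.2]))) => //.
apply: (@measurableT_comp _ _ _ _ _ _ g) => //; apply: measurable_fun_pair.
  exact: measurableT_comp.
by apply: measurable_cons => //; exact: measurableT_comp.
Qed.

Lemma measurable_tuple_cons (n : nat) (g : n.+1.-tuple R -> \bar R) :
  measurable_fun setT g ->
  measurable_fun setT (fun z : R * n.-tuple R => g [tuple of z.1 :: z.2]).
Proof.
move=> mg; apply: (@measurableT_comp _ _ _ _ _ _ g) => //.
exact: measurable_cons.
Qed.

Lemma measurable_tuple_consr (n : nat) (g : n.+1.-tuple R -> \bar R) (x : R) :
  measurable_fun setT g ->
  measurable_fun setT (fun t : n.-tuple R => g [tuple of x :: t]).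
Proof.
move=> mg; apply: (@measurableT_comp _ _ _ _ _ _ g) => //.
exact: measurable_cons.
Qed.

Lemma measurable_tint_cons (n : nat) (g : n.+1.-tuple R -> \bar R) :
  measurable_fun setT g -> (forall t, 0 <= g t)%E ->
  measurable_fun setT (fun x : R => tint n (fun t => g [tuple of x :: t])).
Proof.
move=> mg g0.
apply: (measurable_tint n (fun z : R * n.-tuple R => g [tuple of z.1 :: z.2])) => //.
exact: measurable_tuple_cons.
Qed.

Lemma tint_sum (n : nat) (I : Type) (r : seq I) (g : I -> n.-tuple R -> \bar R) :
  (forall i, measurable_fun setT (g i)) -> (forall i t, 0 <= g i t)%E ->
  tint n (fun t => \sum_(i <- r) g i t)%E = (\sum_(i <- r) tint n (g i))%E.
Proof.
elim: n g => [//|n IH] g mg g0 /=.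
rewrite -ge0_integral_sum//.
- apply: eq_integral => x _; rewrite IH// => i.
  exact: measurable_tuple_consr.
- by move=> i; exact: measurable_tint_cons.
- by move=> i x _; exact: tint_ge0.
Qed.

Lemma tintZl (n : nat) (k : R) (g : n.-tuple R -> \bar R) :
  measurable_fun setT g -> (forall t, 0 <= g t)%E -> 0 <= k ->
  tint n (fun t => k%:E * g t)%E = (k%:E * tint n g)%E.
Proof.
elim: n g => [//|n IH] g mg g0 k0 /=.
rewrite -ge0_integralZl//.
- apply: eq_integral => x _; rewrite IH//.
  exact: measurable_tuple_consr.
- exact: measurable_tint_cons.
- by move=> x _; exact: tint_ge0.
Qed.

Lemma tint_gdens (n : nat) (mu : n.-tuple R) (s : R) : 0 < s ->
  tint n (fun y => (gdens mu s y)%:E) = 1%E.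
Proof.
move=> s0.
have p0 m y : 0 <= phi m s y.
  by rewrite mulr_ge0 ?expR_ge0// invr_ge0 mulr_ge0 ?sqrtr_ge0// ltW.
have phiE m : phi m s = normal_pdf m s.
  rewrite normal_pdfE ?gt_eqF//; apply/funext => y; rewrite /phi; congr (_ * _).
    rewrite /normal_peak -mulrnAr [in RHS]sqrtrM ?sqr_ge0// sqrtr_sqr gtr0_norm//.
    by rewrite -[pi *+ 2]mulr_natl [in RHS]mulrC.
  by rewrite /normal_fun mulr_natl.
have mphi m : measurable_fun setT (phi m s).
  by rewrite phiE; exact: measurable_normal_pdf.
elim: n mu => [|n IH] mu; first by rewrite /= /gdens big_ord0.
rewrite /=.
transitivity (\int[leb]_x (phi (thead mu) s x)%:E)%E; last first.
  by rewrite phiE; exact: integral_normal_pdf.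
apply: eq_integral => x _.
case/tupleP: mu => m mu.
rewrite -[RHS]mule1 -(IH mu) -tintZl//.
- congr tint; apply/funext => t; rewrite -EFinM; congr EFin.
  rewrite /gdens big_ord_recl; congr (_ * _).
  by apply: eq_bigr => i _; rewrite !tnthS.
- apply/measurable_EFinP; rewrite /gdens; apply: measurable_prod => i _.
  apply: (@measurableT_comp _ _ _ _ _ _ (phi (tnth mu i) s)) => //.
  exact: measurable_tnth.
- by move=> t; rewrite lee_fin prodr_ge0.
Qed.

End iterated_integral.

(** * Rigid motions fixing the origin, and rotational invariance of [alpha] *)

Section rigid_motions.
Context {R : realType}.
Notation leb := (@lebesgue_measure R).

Definition sqdist (n : nat) (a b : n.-tuple R) : R :=
  \sum_(i < n) (tnth a i - tnth b i) ^+ 2.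

Lemma sqdist_cons (n : nat) (x y : R) (a b : n.-tuple R) :
  sqdist n.+1 [tuple of x :: a] [tuple of y :: b] =
  (x - y) ^+ 2 + sqdist n a b.
Proof.
rewrite /sqdist big_ord_recl; congr (_ + _).
by apply: eq_bigr => i _; rewrite !tnthS.
Qed.

Lemma sqdist_ge0 (n : nat) (a b : n.-tuple R) : 0 <= sqdist n a b.
Proof. by apply: sumr_ge0 => i _; exact: sqr_ge0. Qed.

Lemma zero_tupleS (n : nat) :
  zero_tuple R n.+1 = [tuple of 0 :: zero_tuple R n].
Proof. exact: val_inj. Qed.

Lemma behead_tuple_cons (n : nat) (x : R) (t : n.-tuple R) :
  [tuple of behead [tuple of x :: t]] = t.
Proof. exact: val_inj. Qed.

Lemma measurable_thead (n : nat) :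
  measurable_fun setT (fun t : n.+1.-tuple R => thead t).
Proof. exact: measurable_tnth. Qed.

(** What a change of variables in a Gaussian expectation requires: the integral and all distances
    are preserved, and the auxiliary law stays centred. *)
Record rigid (n : nat) (F : n.-tuple R -> n.-tuple R) : Prop := Rigid {
  rigid_measurable : measurable_fun setT F ;
  rigid_tint : forall g : n.-tuple R -> \bar R,
    measurable_fun setT g -> (forall t, 0 <= g t)%E ->
    tint n (fun t => g (F t)) = tint n g ;
  rigid_sqdist : forall a b, sqdist n (F a) (F b) = sqdist n a b ;
  rigid_zero : F (zero_tuple R n) = zero_tuple R n }.

Lemma rigid_comp (n : nat) (F G : n.-tuple R -> n.-tuple R) :
  rigid n F -> rigid n G -> rigid n (G \o F).
Proof.
move=> [mF iF dF F0] [mG iG dG G0]; split => /=.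
- exact: measurableT_comp.
- move=> g mg g0; rewrite (iF (fun t => g (G t))) ?iG//.
  exact: measurableT_comp.
- by move=> a b; rewrite dG dF.
- by rewrite F0.
Qed.

Definition fix_head (n : nat) (F : n.-tuple R -> n.-tuple R)
  (t : n.+1.-tuple R) : n.+1.-tuple R :=
  [tuple of thead t :: F [tuple of behead t]].

Lemma fix_headE (n : nat) (F : n.-tuple R -> n.-tuple R) x (t : n.-tuple R) :
  fix_head n F [tuple of x :: t] = [tuple of x :: F t].
Proof. by rewrite /fix_head theadE behead_tuple_cons. Qed.

Lemma rigid_fix_head (n : nat) (F : n.-tuple R -> n.-tuple R) :
  rigid n F -> rigid n.+1 (fix_head n F).
Proof.
move=> [mF iF dF F0]; split.
- apply: measurable_cons; first exact: measurable_thead.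
  by apply: measurableT_comp => //; exact: measurable_behead.
- move=> g mg g0 /=; apply: eq_integral => x _.
  under [X in tint n X]eq_fun do rewrite fix_headE.
  by rewrite (iF (fun t => g [tuple of x :: t]))//; exact: measurable_tuple_consr.
- move=> a b; case/tupleP: a => x a; case/tupleP: b => y b.
  by rewrite !fix_headE !sqdist_cons dF.
- by rewrite zero_tupleS fix_headE F0.
Qed.

Lemma rigid_opp : rigid 1 (fun t => [tuple - thead t]).
Proof.
split.
- by apply: measurable_cons => //; apply: measurableT_comp => //; exact: measurable_thead.
- move=> g mg g0 /=.
  rewrite [RHS](@ge0_integral_affine R (-1) 0) ?oppr_eq0 ?oner_eq0//; last first.
    by apply: (@measurableT_comp _ _ _ _ _ _ g) => //; exact: measurable_cons.
  rewrite normrN normr1 mul1e; apply: eq_integral => x _.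
  by congr g; apply: val_inj; rewrite /= theadE mulN1r addr0.
- move=> a b; rewrite /sqdist !big_ord1 /thead !(tnth_nth 0)/=; ring.
- by apply: val_inj; rewrite /= /thead (tnth_nth 0)/= oppr0.
Qed.

(** The Givens rotation of the first two coordinates, when [c] and [s] are the cosine and sine of an
    angle. *)
Definition givens (n : nat) (c s : R) (t : n.+2.-tuple R) : n.+2.-tuple R :=
  let x := thead t in
  let y := thead [tuple of behead t] in
  [tuple of c * x + s * y ::
    [tuple of c * y - s * x :: [tuple of behead [tuple of behead t]]]].

Lemma givensE (n : nat) (c s x y : R) (t : n.-tuple R) :
  givens n c s [tuple of x :: [tuple of y :: t]] =
  [tuple of c * x + s * y :: [tuple of c * y - s * x :: t]].
Proof. by rewrite /givens theadE !behead_tuple_cons theadE. Qed.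

Lemma rigid_givens (n : nat) (c s : R) : c ^+ 2 + s ^+ 2 = 1 ->
  rigid n.+2 (givens n c s).
Proof.
move=> cs1.
have mx : measurable_fun setT (fun t : n.+2.-tuple R => thead t).
  exact: measurable_thead.
have my : measurable_fun setT (fun t : n.+2.-tuple R => thead [tuple of behead t]).
  apply: (@measurableT_comp _ _ _ _ _ _ (fun t : n.+1.-tuple R => thead t)).
    exact: measurable_thead.
  exact: measurable_behead.
split.
- apply: measurable_cons.
    by apply: measurable_funD; exact: measurable_funM.
  apply: measurable_cons.
    by apply: measurable_funB; exact: measurable_funM.
  apply: (@measurableT_comp _ _ _ _ _ _ (fun t : n.+1.-tuple R => [tuple of behead t])).
    exact: measurable_behead.
  exact: measurable_behead.
- move=> g mg g0 /=.
  pose h (z : R * R) := tint n (fun t => g [tuple of z.1 :: [tuple of z.2 :: t]]).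
  have mh : measurable_fun setT h.
    apply: (measurable_tint n (fun z : (R * R) * n.-tuple R =>
      g [tuple of z.1.1 :: [tuple of z.1.2 :: z.2]])) => //.
    apply: (@measurableT_comp _ _ _ _ _ _ g) => //.
    apply: measurable_cons; first exact: measurableT_comp.
    by apply: measurable_cons => //; exact: measurableT_comp.
  have h0 z : (0 <= h z)%E by exact: tint_ge0.
  transitivity (\int[leb]_x \int[leb]_y h (c * x + s * y, c * y - s * x)%R)%E.
    apply: eq_integral => x _; apply: eq_integral => y _; rewrite /h /=.
    by congr tint; apply/funext => t; rewrite givensE.
  exact: (ge0_integral_rotation c s h cs1 mh h0).
- move=> a b; case/tupleP: a => x a; case/tupleP: a => y a.
  case/tupleP: b => x' b; case/tupleP: b => y' b.
  rewrite !givensE !sqdist_cons !addrA; congr (_ + _).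
  transitivity ((c ^+ 2 + s ^+ 2) * ((x - x') ^+ 2 + (y - y') ^+ 2)); first by ring.
  by rewrite cs1 mul1r.
- rewrite !zero_tupleS givensE; apply: val_inj => /=.
  by rewrite !mulr0 addr0 subrr.
Qed.

Lemma rigid_id (n : nat) : rigid n id.
Proof. by split=> //; exact: measurable_id. Qed.

Lemma givens_transitive (n : nat) (x y x' y' : R) (t : n.-tuple R) :
  x ^+ 2 + y ^+ 2 = x' ^+ 2 + y' ^+ 2 ->
  exists2 F, rigid n.+2 F &
    F [tuple of x :: [tuple of y :: t]] = [tuple of x' :: [tuple of y' :: t]].
Proof.
set N := x ^+ 2 + y ^+ 2 => EN.
have [N0|N0] := eqVneq N 0.
  exists id; first exact: rigid_id.
  have /andP[/eqP-> /eqP->] : (x == 0) && (y == 0).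
    by move/eqP: N0; rewrite paddr_eq0 ?sqr_ge0// !sqrf_eq0.
  suff /andP[/eqP-> /eqP->] : (x' == 0) && (y' == 0) by [].
  by move/eqP: N0; rewrite EN paddr_eq0 ?sqr_ge0// !sqrf_eq0.
(* Inner product and determinant of the two vectors over their common squared norm: the cosine and
   sine of the angle from [(x', y')] to [(x, y)]. *)
pose c := (x * x' + y * y') / N; pose s := (y * x' - x * y') / N.
exists (givens n c s).
  apply: rigid_givens.
  have -> : c ^+ 2 + s ^+ 2 = N * (x' ^+ 2 + y' ^+ 2) / N ^+ 2.
    by rewrite /c /s; rewrite /N in N0 *; field.
  by rewrite -EN; field.
rewrite givensE; apply: val_inj => /=; congr [:: _, _ & _].
- by rewrite /c /s; rewrite /N in N0 *; field.
- by rewrite /c /s; rewrite /N in N0 *; field.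
Qed.

(** Induction on the dimension: move the tail of [a] onto its first axis, rotate the first two
    coordinates, then move the tail from that axis to the tail of [b]. *)
Lemma rigid_transitive (n : nat) (a b : n.-tuple R) :
  sqdist n a (zero_tuple R n) = sqdist n b (zero_tuple R n) ->
  exists2 F, rigid n F & F a = b.
Proof.
case: n a b => [|n].
  by move=> a b _; exists id; [exact: rigid_id|rewrite (tuple0 a) (tuple0 b)].
elim: n => [|n IH] a b.
  case/tupleP: a => x a; case/tupleP: b => y b.
  (* In dimension one equal norms mean equality up to sign, whence the reflection. *)
  rewrite (tuple0 a) (tuple0 b) zero_tupleS !sqdist_cons !subr0 => /addIr /eqP.
  rewrite eqf_sqr => /orP[]/eqP->; first by exists id => //; exact: rigid_id.
  exists (fun t => [tuple - thead t]); first exact: rigid_opp.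
  by apply: val_inj; rewrite /= theadE opprK.
case/tupleP: a => x a; case/tupleP: b => y b.
rewrite zero_tupleS !sqdist_cons !subr0 => E.
pose r (t : n.+1.-tuple R) := Num.sqrt (sqdist n.+1 t (zero_tuple R n.+1)).
(* [p t] is the point of the first axis with the same norm as [t]. *)
pose p t := [tuple of r t :: zero_tuple R n].
have r2 t : r t ^+ 2 = sqdist n.+1 t (zero_tuple R n.+1).
  by rewrite sqr_sqrtr// sqdist_ge0.
have dp t : sqdist n.+1 (p t) (zero_tuple R n.+1) = sqdist n.+1 t (zero_tuple R n.+1).
  rewrite -[RHS]r2 /p zero_tupleS sqdist_cons subr0 -[RHS]addr0; congr (_ + _).
  by rewrite /sqdist big1// => i _; rewrite subrr expr0n.
have [F1 rF1 F1a] := IH a (p a) (esym (dp a)).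
have [F3 rF3 F3b] := IH (p b) b (dp b).
have [F2 rF2 F2E] : exists2 F, rigid n.+2 F &
    F [tuple of x :: p a] = [tuple of y :: p b].
  by apply: givens_transitive; rewrite !r2.
exists (fix_head n.+1 F3 \o (F2 \o fix_head n.+1 F1)).
  exact: (rigid_comp _ _ _ (rigid_comp _ _ _ (rigid_fix_head _ _ rF1) rF2)
    (rigid_fix_head _ _ rF3)).
by rewrite /= fix_headE F1a F2E fix_headE F3b.
Qed.

(** Makes visible that the density depends on [y] and [mu] only through their distance. *)
Lemma gdensE (n : nat) (mu : n.-tuple R) (s : R) (y : n.-tuple R) :
  gdens mu s y = (Num.sqrt (2 * pi) * s)^-1 ^+ n *
                 expR (- sqdist n y mu / (2 * s ^+ 2)).
Proof.
rewrite /gdens /phi big_split/= prodr_const card_ord -expR_sum.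
by rewrite /sqdist -mulr_suml sumrN.
Qed.

Lemma gdens_ge0 (n : nat) (mu : n.-tuple R) (s : R) (y : n.-tuple R) :
  0 < s -> 0 <= gdens mu s y.
Proof.
move=> s0; rewrite gdensE mulr_ge0 ?expR_ge0// exprn_ge0// invr_ge0.
by rewrite mulr_ge0 ?sqrtr_ge0// ltW.
Qed.

Lemma measurable_gdens (n : nat) (mu : n.-tuple R) (s : R) :
  measurable_fun setT (gdens mu s).
Proof.
rewrite /gdens; apply: measurable_prod => i _.
apply: (@measurableT_comp _ _ _ _ _ _ (phi (tnth mu i) s)); last first.
  exact: measurable_tnth.
apply: measurable_funM => //; apply: measurableT_comp => //.
apply: measurable_funM => //; apply: measurableT_comp => //.
by apply: measurable_funX; exact: measurable_funB.
Qed.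

Lemma Egauss_rigid (n : nat) (F : n.-tuple R -> n.-tuple R) (mu : n.-tuple R)
    (s : R) (T : n.-tuple R -> R) :
  rigid n F -> 0 < s -> measurable_fun setT T -> (forall y, 0 <= T y) ->
  Egauss mu s (T \o F) = Egauss (F mu) s T.
Proof.
move=> [mF iF dF F0] s0 mT T0; rewrite !EgaussE.
rewrite -(iF (fun y => (T y * gdens (F mu) s y)%:E)).
- by congr tint; apply/funext => y; rewrite /= !gdensE dF.
- by apply/measurable_EFinP/measurable_funM => //; exact: measurable_gdens.
- by move=> y; rewrite lee_fin mulr_ge0// gdens_ge0.
Qed.

(** Each test [T] for the mean [F mu] pulls back to [T \o F] for [mu] with the same two
    expectations, because [F] fixes the origin. *)
Lemma alpha_le_rigid (n : nat) (F : n.-tuple R -> n.-tuple R) (mu : n.-tuple R)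
    (beta sA sB : R) : rigid n F -> 0 < sA -> 0 < sB ->
  (alpha beta mu sA (zero_tuple R n) sB <=
   alpha beta (F mu) sA (zero_tuple R n) sB)%E.
Proof.
move=> rF sA0 sB0; apply: le_ereal_inf => _ [T [[mT T01] Tbeta] <-].
have T0 y : 0 <= T y by case/andP: (T01 y).
exists (T \o F); last by rewrite Egauss_rigid.
split; first split.
- by apply: measurableT_comp => //; exact: rigid_measurable rF.
- by move=> y; exact: T01.
- by rewrite Egauss_rigid// (rigid_zero _ _ rF).
Qed.

(** The constant vector [sqrt gamma] has squared norm [n * gamma], as does [mu], so a rigid motion
    carries it to [mu]. *)
Lemma fmc_le_alpha (n : nat) (mu : n.-tuple R) (beta gamma sigma theta : R) :
  0 < sigma -> 0 < theta -> 0 <= gamma ->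
  \sum_(k < n) tnth mu k ^+ 2 = n%:R * gamma ->
  (fmc n sigma theta beta gamma <=
   alpha beta mu sigma (zero_tuple R n) theta)%E.
Proof.
move=> s0 t0 g0 Emu.
have [|F rF <-] := rigid_transitive n (cst_tuple n (Num.sqrt gamma)) mu.
  rewrite /sqdist; transitivity (n%:R * gamma).
    rewrite (eq_bigr (fun=> gamma)); first by rewrite sumr_const card_ord mulr_natl.
    by move=> i _; rewrite /cst_tuple /zero_tuple !tnth_nseq subr0 sqr_sqrtr.
  rewrite -Emu; apply: eq_bigr => i _.
  by rewrite /zero_tuple tnth_nseq subr0.
exact: alpha_le_rigid.
Qed.

End rigid_motions.

(** * Decoding regions as tests, and the bound for each message *)

Section meta_converse.
Context {R : realType}.

Lemma Egauss_ge0 (n : nat) (mu : n.-tuple R) (s : R) (T : n.-tuple R -> R) :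
  0 < s -> (forall y, 0 <= T y) -> (0 <= Egauss mu s T)%E.
Proof.
move=> s0 T0; rewrite EgaussE; apply: tint_ge0 => y.
by rewrite lee_fin mulr_ge0// gdens_ge0.
Qed.

Lemma Egauss_sum1 (n : nat) (mu : n.-tuple R) (s : R) (I : finType)
    (T : I -> n.-tuple R -> R) : 0 < s ->
  (forall i, measurable_fun setT (T i)) -> (forall i y, 0 <= T i y) ->
  (forall y, \sum_i T i y = 1) ->
  (\sum_i Egauss mu s (T i) = 1)%E.
Proof.
move=> s0 mT T0 T1.
under eq_bigr do rewrite EgaussE.
rewrite -tint_sum.
- rewrite -(tint_gdens n mu s s0); congr tint; apply/funext => y.
  by rewrite sumEFin -mulr_suml T1 mul1r.
- by move=> i; apply/measurable_EFinP/measurable_funM => //; exact: measurable_gdens.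
- by move=> i y; rewrite lee_fin mulr_ge0// gdens_ge0.
Qed.

Lemma Egauss_compl (n : nat) (mu : n.-tuple R) (s : R) (T : n.-tuple R -> R) :
  0 < s -> measurable_fun setT T -> (forall y, 0 <= T y <= 1) ->
  (Egauss mu s T + Egauss mu s (fun y => 1 - T y)%R = 1)%E.
Proof.
move=> s0 mT T01.
rewrite -(Egauss_sum1 n mu s bool (fun b y => if b then T y else 1 - T y) s0).
- by rewrite big_bool.
- by case => //; exact: measurable_funB.
- by move=> [] y; have /andP[? ?] := T01 y => //; rewrite subr_ge0.
- by move=> y; rewrite big_bool/= addrCA subrr addr0.
Qed.

Lemma Egauss0 (n : nat) (mu : n.-tuple R) (s : R) :
  Egauss mu s (fun=> 0) = 0%E.
Proof.
rewrite EgaussE; under [X in tint n X]eq_fun do rewrite mul0r.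
by elim: n {mu} => [//|n IH] /=; under eq_integral do rewrite IH; rewrite integral0.
Qed.

(** The null test is admissible at every nonnegative level. The bound is uniform in [gamma], which
    later forces the sign of [b]. *)
Lemma fmc_le1 (n : nat) (sigma theta beta gamma : R) : 0 <= beta ->
  (fmc n sigma theta beta gamma <= 1)%E.
Proof.
move=> b0; apply: ereal_inf_lbound; exists (fun=> 0); last first.
  by rewrite Egauss0 sube0.
by split; [split=> [//|y]; rewrite lexx ler01|rewrite Egauss0 lee_fin].
Qed.

Lemma measurable_lik (n M : nat) (sigma : R) (c : 'I_M -> n.-tuple R) i :
  measurable_fun setT (lik sigma c i).
Proof. exact: measurable_gdens. Qed.

Lemma measurable_ml_err (n M : nat) (sigma : R) (c : 'I_M -> n.-tuple R) i :
  measurable_fun setT (ml_err sigma c i).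
Proof.
(* The error event is a finite union of sets comparing two measurable likelihoods. *)
pose E := \bigcup_(j in [set: 'I_M])
  ([set y | lik sigma c i y < lik sigma c j y] `|`
   [set y | lik sigma c j y = lik sigma c i y /\ (j < i)%N]).
have mE : measurable E.
  apply: fin_bigcup_measurable => [|j _]; first exact: finite_finset.
  apply: measurableU.
    have /(_ measurableT [set true] I) := measurable_fun_ltr
      (measurable_lik n M sigma c i) (measurable_lik n M sigma c j).
    by rewrite setTI.
  have [ji|ij] := boolP (j < i)%N; last first.
    rewrite (_ : [set _ | _] = set0)//.
    by apply/seteqP; split => y //= [].
  have /(_ measurableT [set true] I) := measurable_fun_eqr
    (measurable_lik n M sigma c j) (measurable_lik n M sigma c i).
  rewrite setTI; congr measurable; apply/seteqP; split => y /=.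
    by move/eqP.
  by case=> /eqP.
rewrite (_ : ml_err sigma c i = \1_E); first exact: measurable_indic.
apply/funext => y; rewrite /ml_err indicE.
have -> : (y \in E) = `[< exists j : 'I_M, lik sigma c i y < lik sigma c j y \/
                          (lik sigma c j y = lik sigma c i y /\ (j < i)%N) >].
  apply/idP/asboolP; rewrite inE; first by move=> [j _ H]; exists j.
  by move=> [j H]; exists j.
by case: asboolP.
Qed.

Lemma ml_err_01 (n M : nat) (sigma : R) (c : 'I_M -> n.-tuple R) i y :
  0 <= ml_err sigma c i y <= 1.
Proof. by rewrite /ml_err; case: asboolP; rewrite ?lexx ?ler01. Qed.

(** For each output exactly one message is decoded without error: the likelihood maximiser of
    smallest index, [i0] below. *)
Lemma sum_ml_success (n M : nat) (sigma : R) (c : 'I_M -> n.-tuple R) y :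
  (0 < M)%N -> \sum_(i < M) (1 - ml_err sigma c i y) = 1.
Proof.
move=> M0; pose L i := lik sigma c i y.
have [i1 Hi1] : exists i, forall j, L j <= L i.
  exists [arg max_(i > Ordinal M0) L i]%O.
  by case: arg_maxP => // i _ H j; exact: H.
have [i0 [Hi0 Mi0]] : exists i0, (forall j, L j <= L i0) /\
    (forall j : 'I_M, L j = L i0 -> (i0 <= j)%N).
  exists [arg min_(i < i1 | L i == L i1) (i : nat)].
  case: arg_minnP => // i /eqP Ei H; rewrite Ei; split=> // j /eqP.
  exact: H.
rewrite (bigD1 i0)//= big1 ?addr0 => [|i ii0].
  rewrite /ml_err; case: asboolP => [[j [lt|[eq lt]]]|]; last by rewrite subr0.
    by have := le_lt_trans (Hi0 j) lt; rewrite ltxx.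
  by have := Mi0 _ eq; rewrite leqNgt lt.
rewrite /ml_err; case: asboolP => [_|H]; first by rewrite subrr.
exfalso; apply: H; exists i0.
have [lt|ge] := ltP (L i) (L i0); first by left.
have eq : L i = L i0 by apply/le_anti; rewrite Hi0 ge.
right; split; first exact/esym.
by rewrite ltn_neqAle (Mi0 _ eq) andbT eq_sym.
Qed.

(* [beta i] is the probability of the decoding region of message [i] under the
   centred Gaussian of variance [theta ^+ 2]. *)
Lemma meta_converse (n M : nat) (sigma theta : R) (c : 'I_M -> n.-tuple R) :
  0 < sigma -> 0 < theta -> (0 < n)%N -> (0 < M)%N ->
  exists2 beta : 'I_M -> R, \sum_i beta i = 1 &
  forall i, 0 <= beta i <= 1 /\
    (fmc n sigma theta (beta i) (n%:R^-1 * \sum_(k < n) tnth (c i) k ^+ 2) <=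
     Egauss (c i) sigma (ml_err sigma c i))%E.
Proof.
move=> s0 t0 n0 M0.
pose T i y := 1 - ml_err sigma c i y.
have mT i : measurable_fun setT (T i).
  by apply: measurable_funB => //; exact: measurable_ml_err.
have T01 i y : 0 <= T i y <= 1.
  have /andP[? ?] := ml_err_01 n M sigma c i y.
  by apply/andP; split; rewrite /T; lra.
have T0 i y : 0 <= T i y by have /andP[] := T01 i y.
pose B i := Egauss (zero_tuple R n) theta (T i).
have B0 i : (0 <= B i)%E by exact: Egauss_ge0.
have B1 : (\sum_i B i = 1)%E.
  by apply: Egauss_sum1 => // y; exact: sum_ml_success.
have Bfin i : B i \is a fin_num.
  rewrite ge0_fin_numE//; apply: le_lt_trans (ltry (1 : R)).
  by rewrite -B1 (bigD1 i)//= leeDl// sume_ge0.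
have BE i : B i = (fine (B i))%:E by rewrite fineK.
have beta0 i : 0 <= fine (B i) by rewrite -lee_fin -BE.
have S1 : \sum_i fine (B i) = 1.
  by apply: EFin_inj; rewrite -sumEFin -[RHS]B1; apply: eq_bigr => i _; rewrite -BE.
exists (fun i => fine (B i)) => // i; split.
  by rewrite beta0 -S1 (bigD1 i)//= lerDl sumr_ge0.
apply: (@le_trans _ _ (alpha (fine (B i)) (c i) sigma (zero_tuple R n) theta)).
  apply: fmc_le_alpha => //.
    by rewrite mulr_ge0// ?invr_ge0//; apply: sumr_ge0 => k _; exact: sqr_ge0.
  by rewrite mulrA divff ?mul1r// pnatr_eq0 -lt0n.
(* The decoding region is a test of exactly the allowed size, and its missed mass under [c i] is the
   error probability. *)
apply: ereal_inf_lbound; exists (T i); first by split=> //; rewrite -BE.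
have := Egauss_compl n (c i) sigma (ml_err sigma c i) s0
  (measurable_ml_err n M sigma c i) (ml_err_01 n M sigma c i).
rewrite -/(T i) => <-; rewrite addeK// ge0_fin_numE ?Egauss_ge0//.
apply: le_lt_trans (ltry (1 : R)).
rewrite -(Egauss_compl n (c i) sigma (T i) s0 (mT i) (T01 i)) leeDl// Egauss_ge0//.
by move=> y; rewrite subr_ge0; have /andP[] := T01 i y.
Qed.

End meta_converse.

(** * Averaging an affine minorant over the messages *)

Theorem theorem4 (R : realType) (sigma theta : R) (n M : nat) (Ups : R) :
  0 < sigma -> sigma <= theta -> (1 <= n)%N -> (1 <= M)%N -> 0 < Ups ->
  (lower_env (fmc n sigma theta) (M%:R)^-1 Ups <= eps_star n M Ups sigma)%E.
Proof.
move=> s0 st n0 M0 U0.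
have t0 : 0 < theta by exact: lt_le_trans st.
apply: ge_ereal_sup => _ [[a b] _ <-]; apply: le_ereal_inf_tmp => _ [c pc <-] /=.
have [beta beta1 Hbeta] := meta_converse n M sigma theta c s0 t0 n0 M0.
pose gamma i := n%:R^-1 * \sum_(k < n) tnth (c i) k ^+ 2.
have gamma0 i : 0 <= gamma i.
  by rewrite mulr_ge0// ?invr_ge0//; apply: sumr_ge0 => k _; exact: sqr_ge0.
have conjP x y : 0 <= x <= 1 -> 0 <= y ->
    ((a * x + b * y)%:E - fmc n sigma theta x y <=
     conj2 (fmc n sigma theta) a b)%E.
  by move=> x01 y0; apply: ereal_sup_ubound; exists (x, y).
(* A conjugate equal to [+oo] gives the trivial bound [-oo]; the value [-oo] would force [f] to be
   [+oo] at the origin, against [f <= 1]. *)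
case EK : (conj2 (fmc n sigma theta) a b) => [K| |]; last 2 first.
- by rewrite leNye.
- have := conjP 0 0; rewrite EK lexx ler01 => /(_ isT isT).
  rewrite leeNy_eq => /eqP; have := fmc_le1 n sigma theta 0 0 (lexx _).
  by case: (fmc _ _ _ _ _).
have conjK x y r : 0 <= x <= 1 -> 0 <= y ->
    (fmc n sigma theta x y <= r%:E)%E -> a * x + b * y - r <= K.
  move=> x01 y0 fr; have := conjP x y x01 y0; rewrite EK => H.
  rewrite -lee_fin; apply: le_trans H.
  by rewrite EFinB leeB.
have b0 : b <= 0.
  rewrite leNgt; apply/negP => b_gt0.
  (* At [beta = 0] and this [gamma], the minorant inequality with [f <= 1] would give
     [|K| + 2 - 1 <= K]. *)
  have g0 : 0 <= (`|K| + 2) / b.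
    by rewrite divr_ge0 ?addr_ge0// ltW.
  have := conjK 0 ((`|K| + 2) / b) 1; rewrite lexx ler01.
  move=> /(_ isT g0 (fmc_le1 _ _ _ _ _ (lexx _))).
  rewrite mulrCA divff ?gt_eqF// mulr0 add0r mulr1.
  by have := ler_norm K; lra.
have MR : (M%:R : R) != 0 by rewrite pnatr_eq0 -lt0n.
pose e i := Egauss (c i) sigma (ml_err sigma c i).
have e0 i : (0 <= e i)%E.
  by apply: Egauss_ge0 => // y; have /andP[] := ml_err_01 n M sigma c i y.
have efin i : e i \is a fin_num.
  rewrite ge0_fin_numE//; apply: le_lt_trans (ltry (1 : R)).
  rewrite -(Egauss_compl n (c i) sigma (ml_err sigma c i) s0
    (measurable_ml_err n M sigma c i) (ml_err_01 n M sigma c i)).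
  rewrite leeDl// Egauss_ge0// => y.
  by rewrite subr_ge0; have /andP[] := ml_err_01 n M sigma c i y.
rewrite /Pe (eq_bigr (fun i => (fine (e i))%:E)); last by move=> i _; rewrite fineK.
rewrite sumEFin -EFinM -EFinB lee_fin.
have H i : a * beta i + b * gamma i - K <= fine (e i).
  have [b01 fe] := Hbeta i; have := conjK _ _ (fine (e i)) b01 (gamma0 i).
  by rewrite fineK// => /(_ fe); rewrite -/(gamma i); lra.
(* The minorant is affine, so its average over the messages is its value at the averages of
   [beta i], which is [1 / M], and of [gamma i]. *)
apply: (@le_trans _ _ (M%:R^-1 * \sum_(i < M) (a * beta i + b * gamma i - K)));
  last first.
  by rewrite ler_wpM2l ?invr_ge0//; apply: ler_sum.
have -> : \sum_(i < M) (a * beta i + b * gamma i - K) =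
    a * \sum_i beta i + b * (\sum_i gamma i) - M%:R * K.
  by rewrite !mulr_sumr sumrB big_split/= sumr_const card_ord mulr_natl.
have -> : M%:R^-1 * (a * \sum_i beta i + b * (\sum_i gamma i) - M%:R * K) =
    a / M%:R + b * (M%:R^-1 * \sum_i gamma i) - K by rewrite beta1; field.
(* Since [b <= 0], the bound of the mean of [gamma i] by [Ups] is reversed on multiplication by [b],
   as required. *)
rewrite lerB// lerD2l ler_wnM2l//.
by rewrite -mulr_sumr mulrCA ler_pdivrMl ?ltr0n.
Qed.
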